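(* Consider the linear quadratic tracking (LQT) problem described in the context, with conditional value functions $V_{k\to i}$ and value functions $V_k$, where $V_k(x_k)=\mathrm z+\frac12x_k^\top S_kx_k-v_k^\top x_k$. Initialise elements $a_k=V_{k\to k+1}(x_k,x_{k+1})$, $k=S,\dots,T$, of the dual form defined in the context, with parameters, for $k=S,\dots,T-1$, $$A_{k,k+1}=F_k,\quad b_{k,k+1}=c_k,\quad C_{k,k+1}=L_kU_k^{-1}L_k^\top,\quad \eta_{k,k+1}=H_k^\top X_kr_k,\quad J_{k,k+1}=H_k^\top X_kH_k,$$ and, for $V_{T\to T+1}(x_T,x_{T+1})$, $$A_{T,T+1}=0,\quad b_{T,T+1}=0,\quad C_{T,T+1}=0,\quad \eta_{T,T+1}=H_T^\top X_Tr_T,\quad J_{T,T+1}=H_T^\top X_TH_T.$$ Then, for $k=S+1,\dots,T$, $$a_S\otimes a_{S+1}\otimes\cdots\otimes a_{k-1}=V_{S\to k}(x_S,x_k),$$ and, for $k=S,\dots,T$, $$a_k\otimes a_{k+1}\otimes\cdots\otimes a_T=V_{k\to T+1}(x_k,x_{T+1}),$$ where $V_{k\to T+1}$ is a function of the dual form, with parameters denoted $(A_{k,T+1},b_{k,T+1},C_{k,T+1},\eta_{k,T+1},J_{k,T+1})$, satisfying $$V_{k\to T+1}(x_k,0)=V_k(x_k).$$ Furthermore, $V_k(x_k)$ is of the form $\mathrm z+\frac12x_k^\top S_kx_k-v_k^\top x_k$ with $$S_k=J_{k,T+1},\qquad v_k=\eta_{k,T+1}.$$ (Equalities of value functions are understood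 up to additive real constants.)
   Context: LQT problem: for integers $S<T$, dynamics $x_{k+1}=F_kx_k+c_k+L_ku_k$ ($x_k\in\mathbb R^{n_x}$, $u_k\in\mathbb R^{n_u}$), stage costs $\ell_n(x_n,u_n)=\frac12(H_nx_n-r_n)^\top X_n(H_nx_n-r_n)+\frac12u_n^\top U_nu_n$ for $n=S,\dots,T-1$, and terminal cost $\ell_T(x_T)=\frac12(H_Tx_T-r_T)^\top X_T(H_Tx_T-r_T)$, with $X_n$ symmetric positive semidefinite and $U_n$ symmetric positive definite. Value functions: $V_T=\ell_T$, $V_k(x_k)=\min_{u_k}\{\ell_k(x_k,u_k)+V_{k+1}(F_kx_k+c_k+L_ku_k)\}$. It is known that $V_k(x_k)=\mathrm z+\frac12x_k^\top S_kx_k-v_k^\top x_k$ with $S_T=H_T^\top X_TH_T$, $v_T=H_T^\top X_Tr_T$ and, for $k=T-1,\dots,S$, $K_k=(L_k^\top S_{k+1}L_k+U_k)^{-1}L_k^\top S_{k+1}F_k$, $v_k=(F_k-L_kK_k)^\top(v_{k+1}-S_{k+1}c_k)+H_k^\top X_kr_k$, $S_k=F_k^\top S_{k+1}(F_k-L_kK_k)+H_k^\top X_kH_k$. (The matrices $S_k$ are not to be confused with the initial time index $S$.) Conditional value function for $S\le k<i\le T$: $V_{k\to i}(x_k,x_i)=\min_{u_{k:i-1}}\sum_{n=k}^{i-1}\ell_n(x_n,u_n)$ subject to $x_{n+1}=F_nx_n+c_n+L_nu_n$ for $n=k,\dots,i-1$ with endpoints $x_k,x_i$ prescribed, and $+\infty$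 if infeasible. Dual form: an element $V_{k\to i}$ has the dual form with parameters $(A_{k,i},b_{k,i},C_{k,i},\eta_{k,i},J_{k,i})$ if $$V_{k\to i}(x_k,x_i)=\max_{\lambda\in\mathbb R^{n_x}}\Big\{\mathrm z+\tfrac12x_k^\top J_{k,i}x_k-x_k^\top\eta_{k,i}-\tfrac12\lambda^\top C_{k,i}\lambda-\lambda^\top(x_i-A_{k,i}x_k-b_{k,i})\Big\},$$ with $A_{k,i},C_{k,i},J_{k,i}\in\mathbb R^{n_x\times n_x}$ ($C_{k,i},J_{k,i}$ symmetric), $b_{k,i},\eta_{k,i}\in\mathbb R^{n_x}$. Throughout, $\mathrm z$ denotes an undetermined additive real constant, and max/min are suprema/infima in the extended reals. Operator: $(a\otimes b)(x,y)=\min_{z\in\mathbb R^{n_x}}\{V_a(x,z)+V_b(z,y)\}$ for elements $a=V_a$, $b=V_b$; it is associative. *)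

(* Defs.v *)
From mathcomp Require Import all_boot all_order all_algebra.
From mathcomp Require Import all_classical all_reals ereal.

Set Implicit Arguments.
Unset Strict Implicit.
Unset Printing Implicit Defensive.

Import Order.TTheory GRing.Theory Num.Theory.
Local Open Scope ring_scope.
Local Open Scope classical_set_scope.

Definition dot (R : realType) n (x y : 'cV[R]_n) : R := (x^T *m y) ord0 ord0.

Definition quad (R : realType) n (Q : 'M[R]_n) (x : 'cV[R]_n) : R :=
  (x^T *m Q *m x) ord0 ord0.

Definition sym_psd (R : realType) n (Q : 'M[R]_n) : Prop :=
  Q^T = Q /\ forall x : 'cV[R]_n, 0 <= quad Q x.

Definition sym_pd (R : realType) n (Q : 'M[R]_n) : Prop :=
  Q^T = Q /\ forall x : 'cV[R]_n, x != 0 -> 0 < quad Q x.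

Section BackwardRecursion.
Variable X : Type.
Variables (T : int) (init : X) (step : int -> X -> X).

Fixpoint backward_steps (m : nat) : X :=
  if m is m'.+1 then step (T - m%:Z) (backward_steps m') else init.

(* The sequence y_T = init, y_k = step k y_(k+1) for k < T.
   The values at k > T are meaningless. *)
Definition backward (k : int) : X := backward_steps `|T - k|%N.

Lemma backwardT : backward T = init.
Proof. by rewrite /backward subrr. Qed.

Lemma backwardS (k : int) : k < T -> backward k = step k (backward (k + 1)).
Proof.
move=> kT; have E : `|T - k|%N = `|T - (k + 1)%R|%N.+1.
  apply/eqP; rewrite -eqz_nat -addn1 PoszD !gez0_abs ?subr_ge0 ?lezD1 ?ltW //.
  by rewrite opprD addrA subrK.
rewrite /backward E /=; congr (step _ _).
by rewrite -E gez0_abs ?subr_ge0 ?ltW // opprB addrC subrK.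
Qed.

End BackwardRecursion.

(* Data of the tracking problem, indexed by integer times; only the entries at
   times of the horizon matter. ny is the common dimension of the r_n. *)
Record lqt (R : realType) (nx nu ny : nat) := LQT {
  lqt_F : int -> 'M[R]_nx ;
  lqt_c : int -> 'cV[R]_nx ;
  lqt_L : int -> 'M[R]_(nx, nu) ;
  lqt_H : int -> 'M[R]_(ny, nx) ;
  lqt_r : int -> 'cV[R]_ny ;
  lqt_X : int -> 'M[R]_ny ;
  lqt_U : int -> 'M[R]_nu }.

Definition element (R : realType) (nx : nat) : Type :=
  'cV[R]_nx -> 'cV[R]_nx -> \bar R.

Record dual_params (R : realType) (nx : nat) := DualParams {
  dual_A : 'M[R]_nx ;
  dual_b : 'cV[R]_nx ;
  dual_C : 'M[R]_nx ;
  dual_eta : 'cV[R]_nx ;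
  dual_J : 'M[R]_nx }.

Section LQT.
Variables (R : realType) (nx nu ny : nat) (P : lqt R nx nu ny).

Local Notation F := (lqt_F P).
Local Notation c := (lqt_c P).
Local Notation L := (lqt_L P).
Local Notation H := (lqt_H P).
Local Notation r := (lqt_r P).
Local Notation X := (lqt_X P).
Local Notation U := (lqt_U P).

Definition dynamics (n : int) (x : 'cV[R]_nx) (u : 'cV[R]_nu) : 'cV[R]_nx :=
  F n *m x + c n + L n *m u.

Definition terminal_cost (n : int) (x : 'cV[R]_nx) : R :=
  2^-1 * quad (X n) (H n *m x - r n).

Definition stage_cost (n : int) (x : 'cV[R]_nx) (u : 'cV[R]_nu) : R :=
  2^-1 * quad (X n) (H n *m x - r n) + 2^-1 * quad (U n) u.

Definition value (T : int) : int -> 'cV[R]_nx -> \bar R :=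
  backward T (fun x => (terminal_cost T x)%:E)
    (fun k W x => ereal_inf
      (range (fun u => ((stage_cost k x u)%:E + W (dynamics k x u))%E))).

Definition gain (k : int) (S1 : 'M[R]_nx) : 'M[R]_(nu, nx) :=
  invmx ((L k)^T *m S1 *m L k + U k) *m (L k)^T *m S1 *m F k.

(* The pairs (S_k, v_k). *)
Definition riccati (T : int) : int -> 'M[R]_nx * 'cV[R]_nx :=
  backward T ((H T)^T *m X T *m H T, (H T)^T *m X T *m r T)
    (fun k Sv => let: (S1, v1) := Sv in
       let K := gain k S1 in
       ((F k)^T *m S1 *m (F k - L k *m K) + (H k)^T *m X k *m H k,
        (F k - L k *m K)^T *m (v1 - S1 *m c k) + (H k)^T *m X k *m r k)).

(* Infimum over the controls steering x at time k to y at time i, jointly with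
   the trajectory xs they generate; it is +oo when there are none. *)
Definition cond_value (k i : int) : element R nx := fun x y =>
  ereal_inf [set e : \bar R |
    exists (u : int -> 'cV[R]_nu) (xs : int -> 'cV[R]_nx),
      [/\ xs k = x, xs i = y,
          (forall n : int, k <= n < i -> xs (n + 1) = dynamics n (xs n) (u n)) &
          e = (\sum_(0 <= m < `|i - k|%N)
                stage_cost (k + m%:Z) (xs (k + m%:Z)) (u (k + m%:Z)))%:E]].

Definition init_params (T k : int) : dual_params R nx :=
  if k == T then
    DualParams 0 0 0 ((H T)^T *m X T *m r T) ((H T)^T *m X T *m H T)
  else
    DualParams (F k) (c k) (L k *m invmx (U k) *m (L k)^T)
      ((H k)^T *m X k *m r k) ((H k)^T *m X k *m H k).

End LQT.

Section Elements.
Variables (R : realType) (nx : nat).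

Definition quadratic_form (Q : 'M[R]_nx) (v x : 'cV[R]_nx) : \bar R :=
  (2^-1 * quad Q x - dot v x)%:E.

Definition dual_form (z : R) (p : dual_params R nx) : element R nx := fun x y =>
  ereal_sup (range (fun lambda : 'cV[R]_nx =>
    (z + 2^-1 * quad (dual_J p) x - dot x (dual_eta p)
       - 2^-1 * quad (dual_C p) lambda
       - dot lambda (y - dual_A p *m x - dual_b p))%:E)).

Definition has_dual_form (V : element R nx) (p : dual_params R nx) : Prop :=
  [/\ (dual_C p)^T = dual_C p, (dual_J p)^T = dual_J p &
      exists z : R, forall x y, V x y = dual_form z p x y].

Definition otimes (a b : element R nx) : element R nx := fun x y =>
  ereal_inf (range (fun z => (a x z + b z y)%E)).

Fixpoint chain_steps (a : int -> element R nx) (i : int) (m : nat) :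
    element R nx :=
  if m is m'.+1 then otimes (chain_steps a i m') (a (i + m%:Z)) else a i.

(* a_i (x) a_(i+1) (x) ... (x) a_j for i <= j, bracketed to the left. *)
Definition chain (a : int -> element R nx) (i j : int) : element R nx :=
  chain_steps a i `|j - i|%N.

(* Equality up to a real additive constant. *)
Definition eq_cst (f g : 'cV[R]_nx -> \bar R) : Prop :=
  exists z : R, forall x, f x = (g x + z%:E)%E.

Definition eq_cst2 (f g : element R nx) : Prop :=
  exists z : R, forall x y, f x y = (g x y + z%:E)%E.

End Elements.

(* Main.v *)
(** Strong duality for the inner quadratic program identifies each [a_k], [k < T],
    with [V_(k -> k+1)]: the supremum over multipliers is attained when the
    required displacement lies in the range of [L U^-1 L^T], and is [+oo]
    otherwise.  Concatenating trajectories gives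
    [V_(k->i) (x) V_(i->j) = V_(k->j)], whence the forward products.  Backwards,
    [a_T] is the terminal cost at second argument [0] and [+oo] elsewhere, so
    [a_k (x) ... (x) a_T] is the value function at [0] and [+oo] elsewhere: it
    has dual form with [A = b = C = 0], and completing the square in each
    dynamic programming step shows that its quadratic part obeys the Riccati
    recursion. *)
Require Import Defs.
From mathcomp Require Import all_boot all_order all_algebra ring lra zify.
From mathcomp Require Import all_classical all_reals ereal.

Set Implicit Arguments.
Unset Strict Implicit.
Unset Printing Implicit Defensive.

Import Order.TTheory GRing.Theory Num.Theory.
Local Open Scope ring_scope.

(** * Inner products and quadratic forms *)

Section Bilinear.
Variable R : realType.
Implicit Types (n m : nat).

Lemma dotC n (x y : 'cV[R]_n) : dot x y = dot y x.
Proof. by rewrite /dot -[y^T *m x]trmxK trmx_mul trmxK [RHS]mxE. Qed.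

Lemma dotDr n (x y z : 'cV[R]_n) : dot x (y + z) = dot x y + dot x z.
Proof. by rewrite /dot mulmxDr mxE. Qed.

Lemma dotr0 n (x : 'cV[R]_n) : dot x 0 = 0.
Proof. by rewrite /dot mulmx0 mxE. Qed.

Lemma dotNr n (x y : 'cV[R]_n) : dot x (- y) = - dot x y.
Proof. by rewrite /dot mulmxN mxE. Qed.

Lemma dotZr n a (x y : 'cV[R]_n) : dot x (a *: y) = a * dot x y.
Proof. by rewrite /dot -scalemxAr mxE. Qed.

Lemma dotDl n (x y z : 'cV[R]_n) : dot (x + y) z = dot x z + dot y z.
Proof. by rewrite dotC dotDr !(dotC z). Qed.

Lemma dotNl n (x y : 'cV[R]_n) : dot (- x) y = - dot x y.
Proof. by rewrite dotC dotNr dotC. Qed.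

Lemma dotZl n a (x y : 'cV[R]_n) : dot (a *: x) y = a * dot x y.
Proof. by rewrite dotC dotZr dotC. Qed.

Lemma dot_mulmx m n (A : 'M[R]_(m, n)) x y : dot x (A *m y) = dot (A^T *m x) y.
Proof. by rewrite /dot trmx_mul trmxK mulmxA. Qed.

Lemma dot_sym_mulmx n (Q : 'M[R]_n) x y : Q^T = Q ->
  dot x (Q *m y) = dot y (Q *m x).
Proof. by move=> Qs; rewrite dot_mulmx Qs dotC. Qed.

Lemma quadE n (Q : 'M[R]_n) x : quad Q x = dot x (Q *m x).
Proof. by rewrite /quad /dot mulmxA. Qed.

Lemma quadD n (Q : 'M[R]_n) x y : Q^T = Q ->
  quad Q (x + y) = quad Q x + 2 * dot y (Q *m x) + quad Q y.
Proof.
move=> Qs; rewrite !quadE mulmxDr !(dotDl, dotDr).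
by rewrite (dot_sym_mulmx x y Qs); ring.
Qed.

Lemma sym_pd_unitmx n (Q : 'M[R]_n) : sym_pd Q -> Q \in unitmx.
Proof.
case=> Qs Qp; rewrite -row_free_unit; apply: inj_row_free => v vQ.
apply/eqP/contraT => v0; have /Qp : v^T != 0 by rewrite trmx_eq0.
by rewrite /quad trmxK vQ mul0mx mxE ltxx.
Qed.

Lemma sym_pd_psd n (Q : 'M[R]_n) : sym_pd Q -> sym_psd Q.
Proof.
case=> Qs Qp; split=> // x; have [->|/Qp/ltW//] := eqVneq x 0.
by rewrite quadE mulmx0 dotr0.
Qed.

Lemma sym_psd_congr n m (Q : 'M[R]_n) (A : 'M[R]_(n, m)) :
  sym_psd Q -> sym_psd (A^T *m Q *m A).
Proof.
case=> Qs Qp; split=> [|x]; first by rewrite !trmx_mul trmxK Qs mulmxA.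
by rewrite quadE -!mulmxA dot_mulmx trmxK -quadE.
Qed.

Lemma sym_psdD n (Q Q' : 'M[R]_n) : sym_psd Q -> sym_psd Q' -> sym_psd (Q + Q').
Proof.
move=> [Qs Qp] [Qs' Qp']; split=> [|x]; first by rewrite linearD /= Qs Qs'.
by rewrite quadE mulmxDl dotDr -!quadE addr_ge0.
Qed.

Lemma sym_psd_pdD n (Q Q' : 'M[R]_n) : sym_psd Q -> sym_pd Q' -> sym_pd (Q + Q').
Proof.
move=> [Qs Qp] [Qs' Qp']; split=> [|x x0]; first by rewrite linearD /= Qs Qs'.
by rewrite quadE mulmxDl dotDr -!quadE ltr_wpDl ?Qp'.
Qed.

(** Serves twice: it exhibits the duality gap as a square, and it performs the minimisation over the
    control in dynamic programming. *)
Lemma complete_square n (Q : 'M[R]_n) u g : sym_pd Q ->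
  2^-1 * quad Q u + dot u g =
  2^-1 * quad Q (u + invmx Q *m g) - 2^-1 * dot g (invmx Q *m g).
Proof.
move=> Qpd; have [Qs _] := Qpd; have Qu := sym_pd_unitmx Qpd.
rewrite quadD // [quad Q (_ *m _)]quadE (mulKVmx Qu) dot_mulmx Qs (mulKVmx Qu).
by rewrite (dotC (_ *m _) g) (dotC g u); field.
Qed.

(** Fredholm alternative. By symmetry the range of [C] is its row space, and a row outside that
    space is not annihilated by some column of [cokermx C]; such a column lies in the kernel of
    [C]. *)
Lemma sym_range_compl n (C : 'M[R]_n) (w : 'cV[R]_n) : C^T = C ->
  (exists mu, w = C *m mu) \/ (exists2 mu, C *m mu = 0 & dot mu w != 0).
Proof.
move=> Cs; have [/submxP[D wE]|] := boolP (w^T <= C)%MS.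
  by left; exists D^T; rewrite -[w]trmxK wE trmx_mul Cs.
rewrite submxE => wn; right; have /matrix0Pn[i [j wij]] := wn.
exists (col j (cokermx C)); first by rewrite colE mulmxA mulmx_coker mul0mx.
by rewrite dotC /dot colE mulmxA -colE mxE; rewrite (ord1 i) in wij.
Qed.

End Bilinear.

(** * Strong duality for a quadratic cost under a linear constraint *)

Section Duality.
Variable R : realType.

Lemma ereal_inf_min (T : Type) (f : T -> R) (t : T) :
  (forall s, f t <= f s) -> ereal_inf (range (fun s => (f s)%:E)) = (f t)%:E.
Proof.
move=> ft; apply/le_anti/andP; split.
  by apply: ereal_inf_lbound; exists t.
by apply: le_ereal_inf_tmp => _ [s _ <-]; rewrite lee_fin.
Qed.

(** An affine function of nonzero slope takes every real value. *)
Lemma ereal_sup_affine n (mu w : 'cV[R]_n) (z : R) : dot mu w != 0 ->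
  ereal_sup (range (fun t : R => (z - dot (t *: mu) w)%:E)) = +oo%E.
Proof.
move=> muw; rewrite -ereal_sup_real; congr ereal_sup; apply/seteqP; split.
  by move=> _ [t _ <-]; exists (z - dot (t *: mu) w).
move=> _ [s _ <-]; exists ((z - s) / dot mu w) => //.
by rewrite dotZl mulfVK // opprB addrC subrK.
Qed.

(** The gap between primal and dual objectives is half of [quad U (u + invmx U *m (L^T *m mu))]. It
    is nonnegative, which is weak duality, and the Fredholm alternative for [C] gives the converse
    bound. *)
Lemma quadratic_duality n m (U : 'M[R]_m) (L : 'M[R]_(n, m)) (w : 'cV[R]_n) z :
  sym_pd U ->
  ereal_sup (range (fun mu =>
    (z - 2^-1 * quad (L *m invmx U *m L^T) mu - dot mu w)%:E)) =
  ereal_inf [set e | exists2 u, L *m u = w & e = (z + 2^-1 * quad U u)%:E].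
Proof.
move=> Upd; have [Us _] := Upd; have Uu := sym_pd_unitmx Upd.
have [_ Up] := sym_pd_psd Upd; set C := L *m _ *m _.
have Cs : C^T = C by rewrite /C !trmx_mul trmxK trmx_inv Us mulmxA.
have gap mu u : z + 2^-1 * quad U u - (z - 2^-1 * quad C mu - dot mu (L *m u)) =
    2^-1 * quad U (u + invmx U *m (L^T *m mu)).
  have /(congr1 (fun t => t - dot u (L^T *m mu))) := complete_square u (L^T *m mu) Upd.
  rewrite addrK => ->; rewrite [quad C mu]quadE /C -!mulmxA !(dot_mulmx L mu).
  by rewrite (dotC u); ring.
apply/le_anti/andP; split.
  apply: ge_ereal_sup => _ [mu _ <-]; apply: le_ereal_inf_tmp => _ [u <- ->].
  by rewrite lee_fin -subr_ge0 gap mulr_ge0 ?invr_ge0.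
have [[mu wE]|[mu Cmu wmu]] := sym_range_compl w Cs.
  (* This [u] is feasible since [L *m u = C *m mu], and paired with the multiplier [- mu] it has
     zero gap. *)
  set u := invmx U *m (L^T *m mu).
  have Lu : L *m u = w by rewrite wE /u /C !mulmxA.
  apply: (@le_trans _ _ (z + 2^-1 * quad U u)%:E).
    by apply: ereal_inf_lbound; exists u.
  apply: ereal_sup_ubound; exists (- mu) => //; congr EFin.
  apply/esym/eqP; rewrite -subr_eq0 -Lu gap !mulmxN addrN.
  by rewrite quadE mulmx0 dotr0 mulr0.
(* Along multiples of this [mu] the quadratic term vanishes and the dual objective is affine of
   nonzero slope, so the supremum is infinite. *)
rewrite (_ : ereal_sup _ = +oo%E) ?leey //; apply/eqP; rewrite -leye_eq.
rewrite -(ereal_sup_affine z wmu); apply: ereal_sup_le => _ [t _ <-].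
exists (t *: mu) => //; rewrite quadE -scalemxAr Cmu scaler0.
by rewrite dotr0 mulr0 subr0.
Qed.

End Duality.

(** * The min-plus product over the extended reals *)

Section Otimes.
Variables (R : realType) (nx : nat).
Implicit Types (a b c : element R nx).
Local Open Scope ereal_scope.

(** A finite [b] can be moved across the inequality. For infinite [b], nonnegativity of [A] keeps
    the infimum away from [-oo], so that the sum is [+oo]. *)
Lemma le_ereal_infD (A : set (\bar R)) (b e : \bar R) : 0 <= b ->
  (forall t, A t -> 0 <= t) -> (forall t, A t -> e <= t + b) ->
  e <= ereal_inf A + b.
Proof.
case: b => [b||//] _ A0 eA; last first.
  rewrite addey ?leey // gt_eqF // (@lt_le_trans _ _ 0) ?ltNy0 //.
  exact: le_ereal_inf_tmp.
rewrite -leeBlDr //; apply: le_ereal_inf_tmp => t At.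
by rewrite leeBlDr // eA.
Qed.

Lemma ereal_inf_rangeD (T : Type) (f : T -> \bar R) (r : R) :
  ereal_inf (range (fun t => f t + r%:E)) = ereal_inf (range f) + r%:E.
Proof.
apply/le_anti/andP; split; last first.
  apply: le_ereal_inf_tmp => _ [t _ <-]; apply: leeD2r.
  by apply: ereal_inf_lbound; exists t.
rewrite -leeBlDr //; apply: le_ereal_inf_tmp => _ [t _ <-].
by rewrite leeBlDr //; apply: ereal_inf_lbound; exists t.
Qed.

Lemma otimes_ge0 a b : (forall x y, 0 <= a x y) -> (forall x y, 0 <= b x y) ->
  forall x y, 0 <= otimes a b x y.
Proof.
by move=> a0 b0 x y; apply: le_ereal_inf_tmp => _ [z _ <-]; rewrite adde_ge0.
Qed.

(** Both sides are the joint infimum over the two intermediate states; nonnegativity lets addition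
    pass through the inner infimum. *)
Lemma otimesA a b c : (forall x y, 0 <= a x y) -> (forall x y, 0 <= b x y) ->
  (forall x y, 0 <= c x y) ->
  otimes (otimes a b) c = otimes a (otimes b c).
Proof.
move=> a0 b0 c0; apply/funext => x; apply/funext => y; apply/le_anti/andP; split.
  apply: le_ereal_inf_tmp => _ [w _ <-]; rewrite addeC.
  apply: le_ereal_infD => // [_ [z _ <-]|_ [z _ <-]]; first exact: adde_ge0.
  rewrite addeC addeA; apply: le_trans.
    by apply: ereal_inf_lbound; exists z.
  by apply: leeD2r; apply: ereal_inf_lbound; exists w.
apply: le_ereal_inf_tmp => _ [z _ <-].
apply: le_ereal_infD => // [_ [w _ <-]|_ [w _ <-]]; first exact: adde_ge0.
rewrite -addeA; apply: le_trans.
  by apply: ereal_inf_lbound; exists w.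
by apply: leeD2l; apply: ereal_inf_lbound; exists z.
Qed.

Lemma eq_cst2_otimes a a' b b' : eq_cst2 a a' -> eq_cst2 b b' ->
  eq_cst2 (otimes a b) (otimes a' b').
Proof.
move=> [s aE] [t bE]; exists (s + t)%R => x y; rewrite EFinD -EFinD.
rewrite -ereal_inf_rangeD; congr ereal_inf; congr image; apply/funext => z.
by rewrite aE bE EFinD addeACA.
Qed.

End Otimes.

(** * Conditional value functions and concatenation of trajectories *)

Section ConditionalValue.
Variables (R : realType) (nx nu ny : nat) (P : lqt R nx nu ny).
Implicit Types (k i j n : int).

(** The only consequence of definiteness of the weights used in this part: it excludes [-oo] from
    the sums. *)
Definition nonneg_stage k i :=
  forall n x u, k <= n < i -> 0 <= stage_cost P n x u.

Lemma nonneg_stageW k k' i i' :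
  k <= k' -> i' <= i -> nonneg_stage k i -> nonneg_stage k' i'.
Proof. by move=> kk' ii' s0 n x u nk; apply: s0; lia. Qed.

Lemma cond_value_ge0 k i x y : k <= i -> nonneg_stage k i ->
  (0 <= cond_value P k i x y)%E.
Proof.
move=> ki s0; apply: le_ereal_inf_tmp => _ [u [xs [_ _ _ ->]]].
rewrite lee_fin big_nat sumr_ge0 // => m mi; apply: s0; lia.
Qed.

Lemma sum_stages k i j (f : int -> R) : k <= i -> i <= j ->
  \sum_(0 <= m < `|j - k|%N) f (k + m%:Z) =
  \sum_(0 <= m < `|i - k|%N) f (k + m%:Z) +
  \sum_(0 <= m < `|j - i|%N) f (i + m%:Z).
Proof.
move=> ki ij; rewrite (@big_cat_nat _ _ _ `|i - k|%N) //=; last by lia.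
congr (_ + _); rewrite -{1}[`|i - k|%N]add0n big_addn.
have -> : (`|j - k| - `|i - k|)%N = `|j - i|%N by lia.
by apply: eq_bigr => m _; congr f; lia.
Qed.

(** Cutting a trajectory at time [i] gives one inequality, gluing two trajectories that meet at time
    [i] gives the other. *)
Lemma cond_value_otimes k i j : k <= i -> i <= j -> nonneg_stage k j ->
  otimes (cond_value P k i) (cond_value P i j) = cond_value P k j.
Proof.
move=> ki ij s0; have ki0 := nonneg_stageW (lexx k) ij s0.
have ij0 := nonneg_stageW ki (lexx j) s0.
apply/funext => x; apply/funext => y; apply/le_anti/andP; split.
  apply: le_ereal_inf_tmp => _ [u [xs [xk xj dyn ->]]].
  rewrite (sum_stages (fun n => stage_cost P n (xs n) (u n)) ki ij) EFinD.
  apply: (@le_trans _ _ (cond_value P k i x (xs i) + cond_value P i j (xs i) y)%E).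
    by apply: ereal_inf_lbound; exists (xs i).
  apply: leeD; apply: ereal_inf_lbound; exists u, xs; split=> // n ni;
    by apply: dyn; lia.
apply: le_ereal_inf_tmp => _ [z _ <-].
apply: le_ereal_infD => [|t|t]; first exact: cond_value_ge0.
  move=> [u [xs [_ _ _ ->]]]; rewrite lee_fin big_nat sumr_ge0 // => m mi.
  by apply: ki0; lia.
move=> [u [xs [xk xi dyn ->]]]; rewrite addeC.
apply: le_ereal_infD => [|t'|t'].
- by rewrite lee_fin big_nat sumr_ge0 // => m mi; apply: ki0; lia.
- move=> [u' [xs' [_ _ _ ->]]]; rewrite lee_fin big_nat sumr_ge0 // => m mi.
  by apply: ij0; lia.
move=> [u' [xs' [x'i x'j dyn' ->]]]; apply: ereal_inf_lbound.
(* The glued trajectory switches at [i] itself. The transition from [i - 1] to [i] therefore relies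
   on [xs i = z = xs' i], and so does the initial condition when [k = i]. *)
exists (fun n => if n < i then u n else u' n), (fun n => if n < i then xs n else xs' n).
split.
- case: ifP => // /negbT; rewrite -leNgt => ik.
  by rewrite (_ : k = i) ?x'i -?xi -?xk; [congr xs|]; lia.
- by rewrite ltNge ij.
- move=> n nj; have [ni|ni] := ltP n i; last first.
    by rewrite ifF ?dyn' //; lia.
  rewrite -dyn; last by lia.
  case: ifP => // ni'; have -> : n + 1 = i by lia.
  by rewrite xi.
rewrite (sum_stages (fun n => stage_cost P n (if n < i then xs n else xs' n)
  (if n < i then u n else u' n)) ki ij) EFinD addeC.
congr (_ + _)%E; congr EFin; apply: eq_big_nat => m mi.
  by rewrite !ifF //; lia.
by rewrite !ifT //; lia.
Qed.

Lemma cond_value1 k x y : cond_value P k (k + 1) x y =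
  ereal_inf [set e | exists2 u, dynamics P k x u = y & e = (stage_cost P k x u)%:E].
Proof.
have k1 : `|(k + 1)%R - k|%N = 1%N by lia.
congr ereal_inf; apply/seteqP; split=> e.
  move=> [u [xs [xk xi dyn ->]]]; exists (u k); first by rewrite -xk -dyn ?xi //; lia.
  by rewrite k1 big_nat1 addr0 xk.
move=> [u uy ->]; exists (fun=> u), (fun n => if n == k then x else y).
rewrite eqxx k1 big_nat1 addr0 eqxx; split=> //; first by rewrite ifF //; lia.
move=> n nk; have -> : n = k by lia.
by rewrite eqxx ifF //; lia.
Qed.

(** With an empty horizon the cost is an empty sum and the endpoints must agree: this is the unit of
    [otimes], which starts the induction of [value_otimes]. *)
Lemma cond_value_refl k x y :
  cond_value P k k x y = if x == y then 0%E else +oo%E.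
Proof.
have [<-|/eqP xy] := eqVneq.
  rewrite -[RHS]ereal_inf1; congr ereal_inf; apply/seteqP; split=> e /=.
    by move=> [u [xs [_ _ _ ->]]]; rewrite subrr big_geq.
  move=> ->; exists (fun=> 0), (fun=> x); rewrite subrr big_geq //.
  by split=> // n; lia.
rewrite -[RHS]ereal_inf0; congr ereal_inf; apply/seteqP; split=> e //.
by move=> [u [xs [xk yk _ _]]]; case: xy; rewrite -xk -yk.
Qed.

(** Minimising over the next state and then over the controls reaching it amounts to minimising over
    all controls. *)
Lemma otimes_cond_value1 k (g : 'cV[R]_nx -> \bar R) x y :
  nonneg_stage k (k + 1) -> (forall z, 0 <= g z)%E ->
  otimes (cond_value P k (k + 1)) (fun z _ => g z) x y =
  ereal_inf (range (fun u => (stage_cost P k x u)%:E + g (dynamics P k x u))%E).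
Proof.
move=> s0 g0; apply/le_anti/andP; split.
  apply: le_ereal_inf_tmp => _ [u _ <-]; apply: le_trans.
    by apply: ereal_inf_lbound; exists (dynamics P k x u).
  apply: leeD2r; rewrite cond_value1; apply: ereal_inf_lbound.
  by exists u.
apply: le_ereal_inf_tmp => _ [z _ <-]; rewrite cond_value1.
apply: le_ereal_infD => // t [u uz ->]; first by rewrite lee_fin s0 //; lia.
by apply: ereal_inf_lbound; exists u; rewrite // uz.
Qed.

(** Bellman's principle, by induction on [T - k]: split off the first stage, reassociate, and
    recognise one dynamic programming step. The terminal element ignores its second argument, so [y]
    is a dummy. *)
Lemma value_otimes T k x y : k <= T -> nonneg_stage k T ->
  (forall z, 0 <= terminal_cost P T z) ->
  value P T k x = otimes (cond_value P k T) (fun z _ => (terminal_cost P T z)%:E) x y.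
Proof.
move=> kT s0 t0; have [m kE] : exists m : nat, k = T - m%:Z by exists `|T - k|%N; lia.
elim: m => [|m IHm] in k x kT s0 kE *.
  rewrite kE subr0 /value backwardT; apply/le_anti/andP; split.
    apply: le_ereal_inf_tmp => _ [z _ <-]; rewrite cond_value_refl.
    by have [->|_] := eqVneq x z; rewrite ?add0e // addye // leey.
  by apply: ereal_inf_lbound; exists x; rewrite // cond_value_refl eqxx add0e.
have k1T : k + 1 <= T by lia.
have s01 : nonneg_stage (k + 1) T by apply: nonneg_stageW s0; lia.
rewrite /value backwardS -/(value P T); last by lia.
rewrite -(@cond_value_otimes k (k + 1) T) //; last by lia.
rewrite otimesA => [|z w|z w|z w]; last first.
- by rewrite lee_fin.
- exact: cond_value_ge0.
- by apply: cond_value_ge0; [lia|apply: nonneg_stageW s0; lia].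
have s0k : nonneg_stage k (k + 1) by apply: nonneg_stageW s0; lia.
(* The induction hypothesis also supplies the nonnegativity of the next value function. *)
rewrite -(@otimes_cond_value1 k _ x y s0k) => [|z]; last first.
  rewrite (IHm (k + 1) z) //; last by lia.
  by apply: otimes_ge0 => z' w; [exact: cond_value_ge0|rewrite lee_fin].
congr ereal_inf; congr image; apply/funext => z; congr (_ + _)%E.
rewrite (IHm (k + 1) z) //; last by lia.
Qed.

End ConditionalValue.

(** * Riccati recursion for the value functions *)

Section Riccati.
Variables (R : realType) (nx nu ny : nat) (P : lqt R nx nu ny).

Local Notation F := (lqt_F P).
Local Notation c := (lqt_c P).
Local Notation L := (lqt_L P).
Local Notation H := (lqt_H P).
Local Notation r := (lqt_r P).
Local Notation X := (lqt_X P).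
Local Notation U := (lqt_U P).

Lemma stage_cost_ge0 n x u : sym_psd (X n) -> sym_pd (U n) ->
  0 <= stage_cost P n x u.
Proof.
by move=> [_ Xp] /sym_pd_psd[_ Up]; rewrite addr_ge0 // mulr_ge0 ?invr_ge0.
Qed.

(** Used at every time, since the state part of [stage_cost] is the same expression. *)
Lemma terminal_costE n x : sym_psd (X n) ->
  terminal_cost P n x =
  2^-1 * quad ((H n)^T *m X n *m H n) x - dot x ((H n)^T *m X n *m r n) +
  2^-1 * quad (X n) (r n).
Proof.
move=> [Xs _]; rewrite /terminal_cost quadD // !quadE !mulmxN !(dotNl, dotNr).
rewrite -!mulmxA !(dot_mulmx (H n)^T) !trmxK.
by rewrite (dot_sym_mulmx (r n) _ Xs); field.
Qed.

Lemma riccatiT T : riccati P T T = ((H T)^T *m X T *m H T, (H T)^T *m X T *m r T).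
Proof. exact: backwardT. Qed.

Lemma riccatiS T k : k < T ->
  let S1 := (riccati P T (k + 1)).1 in let v1 := (riccati P T (k + 1)).2 in
  let K := gain P k S1 in
  riccati P T k =
  ((F k)^T *m S1 *m (F k - L k *m K) + (H k)^T *m X k *m H k,
   (F k - L k *m K)^T *m (v1 - S1 *m c k) + (H k)^T *m X k *m r k).
Proof. 
move=> kT /=; rewrite [LHS](backwardS _ _ kT) -/(riccati P T).
by case: (riccati P T (k + 1)).
Qed.

Section Step.
Variables (k : int) (S1 : 'M[R]_nx) (v1 : 'cV[R]_nx).
Hypotheses (X_psd : sym_psd (X k)) (U_pd : sym_pd (U k)) (S1_psd : sym_psd S1).

Let G := (L k)^T *m S1 *m L k + U k.
Let K := gain P k S1.

Let G_pd : sym_pd G.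
Proof. by apply: sym_psd_pdD => //; exact: sym_psd_congr. Qed.

Let GV_sym : (invmx G)^T = invmx G.
Proof. by rewrite trmx_inv G_pd.1. Qed.

(** The first summand equals the closed-loop form, [quad S1] at the state [(F - L K) x] plus
    [quad U] at the control [K x], because [K] solves the normal equation [GK]. *)
Lemma riccati_psd : sym_psd ((F k)^T *m S1 *m (F k - L k *m K) + (H k)^T *m X k *m H k).
Proof.
apply: sym_psdD; last exact: sym_psd_congr.
have [S1s S1p] := S1_psd; have [_ Up] := sym_pd_psd U_pd.
split=> [|x].
  rewrite /K /gain -/G mulmxBr linearB /= !trmx_mul trmxK S1s.
  by rewrite trmxK GV_sym !mulmxA.
have GK : G *m (K *m x) = (L k)^T *m (S1 *m (F k *m x)).
  by rewrite /K /gain -/G -!mulmxA (mulKVmx (sym_pd_unitmx G_pd)).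
suff -> : quad ((F k)^T *m S1 *m (F k - L k *m K)) x =
    quad S1 (F k *m x - L k *m (K *m x)) + quad (U k) (K *m x).
  by rewrite addr_ge0.
rewrite quadE -2!mulmxA mulmxBl -(mulmxA (L k)).
move: (K *m x) GK => w /(congr1 (dot w)).
rewrite /G mulmxDl dotDr -!mulmxA !(dot_mulmx (_)^T) !trmxK => Gw.
rewrite quadD // !quadE mulmxBr !mulmxN !(dotNl, dotNr, dotDr).
by rewrite (dot_sym_mulmx (F k *m x) (L k *m w) S1s); lra.
Qed.

(** The cost is quadratic in [u] with Hessian [G], so completing the square gives the minimiser;
    what remains is sorted by degree in [x]. *)
Lemma riccati_min : exists z : R, forall x,
  ereal_inf (range (fun u => (stage_cost P k x u +
    (2^-1 * quad S1 (dynamics P k x u) - dot v1 (dynamics P k x u)))%:E)) =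
  (2^-1 * quad ((F k)^T *m S1 *m (F k - L k *m K) + (H k)^T *m X k *m H k) x -
   dot ((F k - L k *m K)^T *m (v1 - S1 *m c k) + (H k)^T *m X k *m r k) x + z)%:E.
Proof.
have [S1s S1p] := S1_psd; have [_ Gp] := sym_pd_psd G_pd.
set d := (L k)^T *m (S1 *m c k - v1).
(* This constant is the minimal cost from [x = 0], where [p] below reduces to [d]. *)
exists (2^-1 * quad (X k) (r k) + 2^-1 * quad S1 (c k) - dot v1 (c k)
  - 2^-1 * dot d (invmx G *m d)) => x.
(* [y] is the successor under zero control and [p] the gradient of the cost at [u = 0]. *)
pose y := F k *m x + c k; pose p := (L k)^T *m (S1 *m y - v1).
have costE u : stage_cost P k x u +
    (2^-1 * quad S1 (dynamics P k x u) - dot v1 (dynamics P k x u)) =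
    2^-1 * quad G (u + invmx G *m p) +
    (terminal_cost P k x + 2^-1 * quad S1 y - dot v1 y - 2^-1 * dot p (invmx G *m p)).
  have /(canRL (subrK _)) -> := esym (complete_square u p G_pd).
  rewrite /stage_cost -/(terminal_cost P k x) /dynamics -/y quadD // !quadE.
  rewrite /G mulmxDl !dotDr /p -!mulmxA !(dot_mulmx (L k)^T) trmxK.
  by rewrite dotDr dotNr (dotC v1 (L k *m u)); field.
pose h u := stage_cost P k x u +
  (2^-1 * quad S1 (dynamics P k x u) - dot v1 (dynamics P k x u)).
rewrite (@ereal_inf_min _ _ h (- (invmx G *m p))); last first.
  move=> u; rewrite /h !costE addNr lerD2r [quad _ 0]quadE mulmx0 dotr0 mulr0.
  by rewrite mulr_ge0 ?invr_ge0 ?Gp.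
congr EFin; rewrite /h costE addNr.
(* Separate the part of [p] linear in [x]: its square corrects [S_k], its cross term with [d]
   corrects [v_k]. *)
have -> : p = (L k)^T *m (S1 *m (F k *m x)) + d.
  by rewrite /p /d /y !mulmxDr !addrA.
have KE : invmx G *m ((L k)^T *m (S1 *m (F k *m x))) = K *m x.
  by rewrite /K /gain -/G -!mulmxA.
have dK : dot ((L k)^T *m (S1 *m (F k *m x))) (invmx G *m d) = dot d (K *m x).
  by rewrite (dot_sym_mulmx _ d GV_sym) KE.
rewrite terminal_costE // mulmxDr !dotDl !dotDr KE dK.
rewrite [quad _ 0]quadE mulmx0 dotr0 mulr0 add0r.
rewrite [quad (_ + _) x]quadE mulmxDl dotDr -!quadE.
have -> : quad ((F k)^T *m S1 *m (F k - L k *m K)) x =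
    quad S1 (F k *m x) - dot ((L k)^T *m (S1 *m (F k *m x))) (K *m x).
  rewrite quadE -2!mulmxA mulmxBl -(mulmxA (L k)) (dot_mulmx (F k)^T) trmxK.
  rewrite mulmxBr dotDr dotNr -quadE (dot_mulmx S1 _ (L k *m _)) S1s.
  by rewrite (dot_mulmx (L k)).
rewrite (dotC (_^T *m (v1 - _)) x) (dot_mulmx (_ - _)^T) trmxK mulmxBl -(mulmxA (L k)).
rewrite /y quadD // (dotC v1) !(dotDl, dotDr, dotNl, dotNr).
have -> : dot d (K *m x) = dot (L k *m (K *m x)) (S1 *m c k) - dot (L k *m (K *m x)) v1.
  by rewrite /d -(dot_mulmx (L k)) (dotC _ (L k *m _)) dotDr dotNr.
rewrite -(dot_mulmx (L k)) (dot_sym_mulmx (c k) (F k *m x) S1s).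
by rewrite (dotC x); field.
Qed.


End Step.

(** Semidefiniteness is carried through the induction because it makes [G] positive definite at the
    preceding time. *)
Lemma value_riccati (T k : int) : k <= T ->
  (forall n, k <= n <= T -> sym_psd (X n)) ->
  (forall n, k <= n < T -> sym_pd (U n)) ->
  sym_psd (riccati P T k).1 /\
  eq_cst (value P T k) (quadratic_form (riccati P T k).1 (riccati P T k).2).
Proof.
move=> kT; have [m kE] : exists m : nat, k = T - m%:Z by exists `|T - k|%N; lia.
elim: m => [|m IHm] in k kT kE * => X_psd U_pd.
  rewrite kE subr0 riccatiT /=; have XT : sym_psd (X T) by apply: X_psd; lia.
  split; first exact: sym_psd_congr.
  exists (2^-1 * quad (X T) (r T)) => x; rewrite /value backwardT terminal_costE //.
  by rewrite /quadratic_form (dotC x) EFinD.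
have kT' : k < T by lia.
have [||n nk|n nk|S1_psd [z valueE]] := IHm (k + 1); try lia.
- by apply: X_psd; lia.
- by apply: U_pd; lia.
have Xk : sym_psd (X k) by apply: X_psd; lia.
have Uk : sym_pd (U k) by apply: U_pd; lia.
rewrite (riccatiS kT') /=; split; first exact: riccati_psd.
have [z' minE] := riccati_min (riccati P T (k + 1)).2 Xk Uk S1_psd.
exists (z' + z) => x; rewrite /value backwardS // -/(value P T).
rewrite (EFinD z') addeA /quadratic_form -(EFinD _ z') -minE -ereal_inf_rangeD.
congr ereal_inf; congr image; apply/funext => u.
by rewrite valueE EFinD addeA.
Qed.

End Riccati.

(** * Dual forms of the elements and their products *)

Section Chain.
Variables (R : realType) (nx nu ny : nat) (P : lqt R nx nu ny).

(** For fixed endpoints the control is constrained by [L u = y - F x - c], and [quadratic_duality]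
    applies with [x] as a parameter. *)
Lemma dual_form_stage (T k : int) (z : R) : k != T ->
  sym_psd (lqt_X P k) -> sym_pd (lqt_U P k) ->
  eq_cst2 (dual_form z (init_params P T k)) (cond_value P k (k + 1)).
Proof.
move=> kT Xk Uk; exists (z - 2^-1 * quad (lqt_X P k) (lqt_r P k)) => x y.
rewrite /init_params (negbTE kT) /dual_form /= cond_value1.
set J := _^T *m _ *m lqt_H P k; set eta := _^T *m _ *m lqt_r P k.
rewrite (quadratic_duality _ _ (z + 2^-1 * quad J x - dot x eta) Uk).
set al := z - _; have costE u :
    z + 2^-1 * quad J x - dot x eta + 2^-1 * quad (lqt_U P k) u =
    stage_cost P k x u + al.
  by rewrite /al /stage_cost -/(terminal_cost P k x) terminal_costE // -/J -/eta; ring.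
have dynE u : lqt_L P k *m u = y - lqt_F P k *m x - lqt_c P k <-> dynamics P k x u = y.
  rewrite -addrA -opprD /dynamics [in X in _ <-> X]addrC.
  by split=> [->|<-]; rewrite ?subrK ?addrK.
apply/le_anti/andP; split.
  rewrite -leeBlDr //; apply: le_ereal_inf_tmp => _ [u /dynE uy ->].
  by rewrite leeBlDr // -EFinD -costE; apply: ereal_inf_lbound; exists u => //; apply/dynE.
apply: le_ereal_inf_tmp => _ [u /dynE uy ->]; rewrite costE (EFinD _ al); apply: leeD2r.
by apply: ereal_inf_lbound; exists u.
Qed.

(** The multiplier enters only through [- dot lambda y], whose supremum is the convex indicator of
    [y = 0]. *)
Lemma dual_form0 (z : R) (eta : 'cV[R]_nx) (J : 'M[R]_nx) x y :
  dual_form z (DualParams 0 0 0 eta J) x y =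
  if y == 0 then (z + 2^-1 * quad J x - dot x eta)%:E else +oo%E.
Proof.
rewrite /dual_form /=; have [->|y0] := eqVneq.
    rewrite -[RHS]ereal_sup1; congr ereal_sup; apply/seteqP; split=> e /=.
    move=> [mu _ <-]; congr EFin.
    by rewrite [quad 0 _]quadE !mul0mx !subr0 !dotr0 mulr0 !subr0.
  move=> ->; exists 0 => //; congr EFin.
  by rewrite [quad 0 _]quadE !mul0mx !subr0 !dotr0 mulr0 !subr0.
have trmx00 : (0 : 'M[R]_nx)^T = 0 by rewrite trmx0.
have [[mu yE]|[mu _ muy]] := sym_range_compl y trmx00.
  by rewrite yE mul0mx eqxx in y0.
rewrite -(ereal_sup_affine (z + 2^-1 * quad J x - dot x eta) muy).
apply/le_anti/andP; split; last first.
  apply: ereal_sup_le => _ [t _ <-]; exists (t *: mu) => //.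
  by rewrite [quad 0 _]quadE !mul0mx dotr0 mulr0 !subr0.
by rewrite ereal_sup_affine ?leey.
Qed.

Lemma chain_cond_value (a : int -> element R nx) (k i : int) : k < i ->
  nonneg_stage P k i ->
  (forall n, k <= n < i -> eq_cst2 (a n) (cond_value P n (n + 1))) ->
  eq_cst2 (chain a k (i - 1)) (cond_value P k i).
Proof.
move=> ki s0 aE; rewrite /chain.
have [m iE] : exists m : nat, i = k + m%:Z + 1 by exists `|(i - 1)%R - k|%N; lia.
have -> : `|(i - 1)%R - k|%N = m by lia.
elim: m => [|m IHm] in i ki s0 aE iE *; first by rewrite iE /= addr0; apply: aE; lia.
(* The last factor of the chain is [a (i - 1)], hence the split at [k + m.+1]. *)
have iE' : i = k + m.+1%:Z + 1 by [].
have s01 : nonneg_stage P k (k + m%:Z + 1) by apply: nonneg_stageW s0; lia.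
rewrite -(@cond_value_otimes _ _ _ _ P k (k + m.+1%:Z)) //; try lia.
apply: eq_cst2_otimes; last by rewrite iE'; apply: aE; lia.
have -> : k + m.+1%:Z = k + m%:Z + 1 by lia.
by apply: IHm => // [|n nk]; [lia|apply: aE; lia].
Qed.

Lemma chain_terminal (a : int -> element R nx) (k T : int) : k < T ->
  chain a k T = otimes (chain a k (T - 1)) (a T).
Proof.
move=> kT; rewrite /chain; have -> : `|T - k|%N = `|(T - 1)%R - k|%N.+1 by lia.
by rewrite /=; congr (otimes _ (a _)); lia.
Qed.

End Chain.

(** * Forward and backward products of the elements *)

Theorem lemma11 (R : realType) (nx nu ny : nat) (S T : int) (ltST : S < T)
    (P : lqt R nx nu ny)
    (X_psd : forall n : int, S <= n <= T -> sym_psd (lqt_X P n))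
    (U_pd : forall n : int, S <= n < T -> sym_pd (lqt_U P n))
    (a : int -> element R nx)
    (a_init : forall k : int, S <= k <= T ->
       has_dual_form (a k) (init_params P T k)) :
  [/\ (forall k : int, S <= k < T -> eq_cst2 (a k) (cond_value P k (k + 1))),
      (forall k : int, S + 1 <= k <= T ->
         eq_cst2 (chain a S (k - 1)) (cond_value P S k)) &
      (forall k : int, S <= k <= T ->
         exists (VT1 : element R nx) (p : dual_params R nx),
           [/\ eq_cst2 (chain a k T) VT1,
               has_dual_form VT1 p,
               eq_cst (fun x => VT1 x 0) (value P T k),
               eq_cst (value P T k)
                 (quadratic_form (riccati P T k).1 (riccati P T k).2) &
               (riccati P T k).1 = dual_J p /\ (riccati P T k).2 = dual_eta p])].
Proof.
have s0 : nonneg_stage P S T.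
  move=> n x u nST; apply: stage_cost_ge0; [apply: X_psd|apply: U_pd]; lia.
have aE k : S <= k < T -> eq_cst2 (a k) (cond_value P k (k + 1)).
  move=> kST; have [|_ _ [z azE]] := a_init k; first by lia.
  have -> : a k = dual_form z (init_params P T k).
    by apply/funext => x; apply/funext => y.
  by apply: dual_form_stage; [lia|apply: X_psd; lia|apply: U_pd; lia].
have chainE k i : S <= k -> k < i -> i <= T ->
    eq_cst2 (chain a k (i - 1)) (cond_value P k i).
  move=> Sk ki iT; apply: chain_cond_value => // [|n nk].
    exact: nonneg_stageW s0.
  by apply: aE; lia.
split=> [//|k kST|k kST]; first by apply: chainE; lia.
have [|_ _ [zT aT]] := a_init T; first by lia.
have {}aT x y : a T x y = (if y == 0 then (terminal_cost P T x)%:E else +oo%E) +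
    (zT - 2^-1 * quad (lqt_X P T) (lqt_r P T))%:E.
  rewrite aT /init_params eqxx dual_form0; case: ifP => // _.
  rewrite -EFinD terminal_costE; last by apply: X_psd; lia.
  by congr EFin; ring.
have [|||S_psd valueE] := @value_riccati _ _ _ _ P T k; try lia.
- by move=> n nk; apply: X_psd; lia.
- by move=> n nk; apply: U_pd; lia.
(* Value function plus indicator of [y = 0] is, by [dual_form0], the dual form with [A = b = C = 0]
   and the Riccati pair as [J] and [eta]. *)
suff [z chainTE] : exists z : R, forall x y,
    chain a k T x y = (if y == 0 then value P T k x else +oo%E) + z%:E.
  exists (chain a k T), (DualParams 0 0 0 (riccati P T k).2 (riccati P T k).1).
  split=> //.
  - by exists 0 => x y; rewrite adde0.
  - case: valueE => z' valueE; split=> /=; [by rewrite trmx0|by case: S_psd|].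
    exists (z' + z) => x y; rewrite dual_form0 chainTE; case: ifP => // _.
    rewrite valueE /quadratic_form -!EFinD (dotC x); congr EFin; ring.
  - by exists z => x; rewrite chainTE eqxx.
pose e : element R nx := fun z w => if w == 0 then (terminal_cost P T z)%:E else +oo%E.
have ae : eq_cst2 (a T) e by eexists; exact: aT.
(* At [k = T] the chain is [a T] alone; there is no product up to [T - 1] to split off. *)
have [kT|kT] := eqVneq k T.
  have [z az] := ae; exists z => x y.
  by rewrite kT /chain subrr /= az /value backwardT.
have kT' : k < T by lia.
have [z chainTE] := eq_cst2_otimes (chainE k T ltac:(lia) kT' (lexx T)) ae.
exists z => x y; rewrite chain_terminal // chainTE; congr (_ + _)%E.
rewrite /otimes /e; case: ifP => [_|_].
  rewrite (value_otimes x y) //; first by lia.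
    by apply: nonneg_stageW s0; lia.
  move=> w; have [|_ XT] := X_psd T; first by lia.
  by rewrite mulr_ge0 ?invr_ge0.
(* For [y] nonzero each candidate is [+oo], as the conditional value is never [-oo]. *)
apply/ereal_inf_pinfty => _ [w _ <-] /=; rewrite addey //.
rewrite gt_eqF // (lt_le_trans ltNy0) //; apply: cond_value_ge0; first by lia.
by apply: nonneg_stageW s0; lia.
Qed.
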